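(* There exist two word metrics $\rho_1$ and $\rho_2$ on the finitely generated nilpotent group $\Gamma=H_3(\mathbb Z)\times\mathbb Z$ which are asymptotic, i.e. $\frac{\rho_1(e,\gamma)}{\rho_2(e,\gamma)}\to1$ as $\gamma\to\infty$ in $\Gamma$, and yet are not at a bounded distance from one another, i.e. $|\rho_1(e,\gamma)-\rho_2(e,\gamma)|$ is unbounded for $\gamma\in\Gamma$.
   Context: $H_3(\mathbb Z)=\langle a,b\mid[a,[a,b]]=[b,[a,b]]=1\rangle$ is the discrete Heisenberg group. A word metric on a finitely generated group $\Gamma$ is $\rho_\Omega(x,y)=\inf\{n\in\mathbb N: x^{-1}y\in\Omega^n\}$ for a finite symmetric generating set $\Omega$ of $\Gamma$. *)

(* Defs.v *)
From HB Require Import structures.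
From mathcomp Require Import all_boot all_order all_algebra generic_quotient.
From mathcomp Require Import all_classical all_reals topology normedtype.
Import Order.TTheory GRing.Theory Num.Theory.
Import numFieldNormedType.Exports.

Set Implicit Arguments.
Unset Strict Implicit.
Unset Printing Implicit Defensive.

Local Open Scope classical_set_scope.
Local Open Scope quotient_scope.

(* The letter (i, false) stands for the generator i, (i, true) for its
   inverse. *)
Definition word (I : Type) := seq (I * bool).

Definition gen_word (I : Type) (i : I) : word I := [:: (i, false)].

Definition inv_letter (I : Type) (l : I * bool) : I * bool := (l.1, ~~ l.2).

Definition inv_word (I : Type) (w : word I) : word I :=
  rev (map (@inv_letter I) w).

Definition comm_word (I : Type) (u v : word I) : word I :=
  inv_word u ++ inv_word v ++ u ++ v.

Inductive pres_cong (I : Type) (rels : set (word I)) :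
    word I -> word I -> Prop :=
| pres_refl u : pres_cong rels u u
| pres_sym u v : pres_cong rels u v -> pres_cong rels v u
| pres_trans u v w :
    pres_cong rels u v -> pres_cong rels v w -> pres_cong rels u w
| pres_cat u u' v v' :
    pres_cong rels u u' -> pres_cong rels v v' ->
    pres_cong rels (u ++ v) (u' ++ v')
| pres_cancel l : pres_cong rels [:: l; inv_letter l] [::]
| pres_rel r : rels r -> pres_cong rels r [::].

Section PresentedGroup.
Variables (I : choiceType) (rels : set (word I)).

Definition pres_rel_bool : rel (word I) := fun u v => `[< pres_cong rels u v >].

Lemma pres_rel_bool_refl : reflexive pres_rel_bool.
Proof. by move=> u; apply/asboolP/pres_refl. Qed.

Lemma pres_rel_bool_sym : symmetric pres_rel_bool.
Proof. by move=> u v; apply/asboolP/asboolP => /pres_sym. Qed.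

Lemma pres_rel_bool_trans : transitive pres_rel_bool.
Proof.
by move=> v u w /asboolP uv /asboolP vw; apply/asboolP; exact: pres_trans vw.
Qed.

Canonical pres_equiv := EquivRel pres_rel_bool
  pres_rel_bool_refl pres_rel_bool_sym pres_rel_bool_trans.

(* The group with generators I and relators rels. *)
Definition presented := {eq_quot pres_equiv}.
HB.instance Definition _ := Choice.on presented.
HB.instance Definition _ := EqQuotient.on presented.

Definition pres_one : presented := \pi_presented [::].
Definition pres_mul (x y : presented) : presented :=
  \pi_presented (repr x ++ repr y).
Definition pres_inv (x : presented) : presented :=
  \pi_presented (inv_word (repr x)).

Lemma pres_piP u v :
  \pi_presented u = \pi_presented v <-> pres_cong rels u v.
Proof.
by split=> [/eqmodP/asboolP|uv]; last exact/eqmodP/asboolP.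
Qed.

Lemma pres_repr u : pres_cong rels (repr (\pi_presented u)) u.
Proof. by apply/pres_piP; rewrite reprK. Qed.

Lemma pres_pi_mul u v :
  pres_mul (\pi_presented u) (\pi_presented v) = \pi_presented (u ++ v).
Proof. by apply/pres_piP/pres_cat; exact: pres_repr. Qed.

Lemma inv_letterK : involutive (@inv_letter I).
Proof. by case=> i b; rewrite /inv_letter /= negbK. Qed.

Lemma inv_wordK : involutive (@inv_word I).
Proof. by move=> w; rewrite /inv_word map_rev revK mapK //; exact: inv_letterK. Qed.

Lemma pres_wordV w : pres_cong rels (w ++ inv_word w) [::].
Proof.
elim: w => [|l w IHw] /=; first exact: pres_refl.
rewrite /inv_word /= rev_cons -cats1 catA.
apply: pres_trans (pres_cancel rels l).
rewrite -[X in pres_cong _ _ X]/([:: l] ++ [::] ++ [:: inv_letter l]) -cat_cons.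
apply: (@pres_cat _ _ [:: l] _ ((w ++ inv_word w) ++ _)); first exact: pres_refl.
by apply: pres_cat IHw _; exact: pres_refl.
Qed.

Lemma pres_mulA : associative pres_mul.
Proof.
elim/quotW=> u; elim/quotW=> v; elim/quotW=> w.
by rewrite (pres_pi_mul v w) (pres_pi_mul u v) !pres_pi_mul catA.
Qed.

Lemma pres_mul1 : left_id pres_one pres_mul.
Proof. by elim/quotW=> u; rewrite pres_pi_mul. Qed.

Lemma pres_mul1r : right_id pres_one pres_mul.
Proof. by elim/quotW=> u; rewrite pres_pi_mul cats0. Qed.

Lemma pres_mulrV : right_inverse pres_one pres_inv pres_mul.
Proof.
move=> x; rewrite -[X in pres_mul X]reprK pres_pi_mul.
by apply/pres_piP; exact: pres_wordV.
Qed.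

Lemma pres_mulV : left_inverse pres_one pres_inv pres_mul.
Proof.
move=> x; rewrite -[X in pres_mul _ X]reprK pres_pi_mul.
by apply/pres_piP; rewrite -[X in _ ++ X]inv_wordK; exact: pres_wordV.
Qed.

HB.instance Definition _ := isGroup.Build presented
  pres_mulA pres_mul1 pres_mul1r pres_mulV pres_mulrV.

End PresentedGroup.

Section DirectProduct.
Variables G H : groupType.

(* MathComp only provides the product of finite groups. *)
Definition dirprod := (G * H)%type.
HB.instance Definition _ := Choice.on dirprod.

Definition dirprod_one : dirprod := (1%g, 1%g).
Definition dirprod_inv (x : dirprod) : dirprod := (x.1^-1, x.2^-1)%g.
Definition dirprod_mul (x y : dirprod) : dirprod := (x.1 * y.1, x.2 * y.2)%g.

Lemma dirprod_mulA : associative dirprod_mul.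
Proof. by move=> x y z; rewrite /dirprod_mul !mulgA. Qed.

Lemma dirprod_mul1 : left_id dirprod_one dirprod_mul.
Proof. by case=> x y; rewrite /dirprod_mul !mul1g. Qed.

Lemma dirprod_mul1r : right_id dirprod_one dirprod_mul.
Proof. by case=> x y; rewrite /dirprod_mul !mulg1. Qed.

Lemma dirprod_mulV : left_inverse dirprod_one dirprod_inv dirprod_mul.
Proof. by move=> x; rewrite /dirprod_mul !mulVg. Qed.

Lemma dirprod_mulrV : right_inverse dirprod_one dirprod_inv dirprod_mul.
Proof. by move=> x; rewrite /dirprod_mul !mulgV. Qed.

HB.instance Definition _ := isGroup.Build dirprod
  dirprod_mulA dirprod_mul1 dirprod_mul1r dirprod_mulV dirprod_mulrV.

End DirectProduct.

(* H_3(Z) = < a, b | [a, [a, b]] = [b, [a, b]] = 1 >, with a := false and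
   b := true as generators. *)
Definition heis_rels : set (word bool) :=
  let a := gen_word false in
  let b := gen_word true in
  [set comm_word a (comm_word a b); comm_word b (comm_word a b)].

Definition H3Z : groupType := presented heis_rels.

(* Algebra.to_multiplicative int is the additive group Z, written multiplicatively. *)
Definition Gamma : groupType := dirprod H3Z (Algebra.to_multiplicative int).

Section WordMetric.
Variable G : groupType.
Implicit Types (Omega K : set G) (x y : G).

Fixpoint set_pow Omega (n : nat) : set G :=
  if n is m.+1 then [set (u * v)%g | u in Omega & v in set_pow Omega m]
  else [set 1%g].

Definition symmetric_set Omega := forall x, Omega x -> Omega (x^-1)%g.

Definition is_subgroup K :=
  K 1%g /\ forall x y, K x -> K y -> K (x / y)%g.

Definition generates Omega := smallest is_subgroup Omega = setT.

Definition word_dist (R : realType) Omega x y : R :=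
  inf [set n%:R%R | n in [set n | set_pow Omega n (x^-1 * y)%g]].

Definition is_word_metric (R : realType) (rho : G -> G -> R) :=
  exists Omega, [/\ finite_set Omega, symmetric_set Omega, generates Omega
    & rho = word_dist R Omega].

End WordMetric.

(* Main.v *)
Require Import Defs.
From mathcomp Require Import all_boot all_order all_algebra.
From mathcomp Require Import all_classical all_reals topology normedtype.
From mathcomp Require Import ring lra zify.
(** Let G be a group with finite symmetric generating set S and word length l,
    and let c be a central element of G.  On G x Z take the metric rho1 of
    the generating set made of S and of the generator of Z and its inverse:
    the length of (h, m) is l(h) + |m|.  The shear (h, m) |-> (h c^m, m) is an
    automorphism because c is central; rho2 is the word metric of the sheared
    generating set, in which (h, m) has length l(h c^-m) + |m|
    ([word_dist_split], [word_dist_shear]).  Hence rho1 and rho2 differ at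
    (h, m) by at most l(c^m), with equality at (c^m, m).

    If c is distorted, i.e. l(c^m) = o(m), this difference is negligible
    against |m|, which both lengths dominate, so the metrics are asymptotic
    ([rho_asymptotic]).  If c has infinite order, l(c^m) is unbounded because
    balls are finite, so the metrics are not at bounded distance
    ([rho_unbounded]).

    In the Heisenberg group c = [a, b] has both properties: the identity
    [a^n, b^n] = c^(n^2) bounds l(c^(n^2)) by 4n ([distorted_commutator]), and
    an action on Z^3 in which c translates the last coordinate shows that the
    powers of c are distinct ([heis_z_inj]). *)

Set Implicit Arguments.
Unset Strict Implicit.
Unset Printing Implicit Defensive.

Import Order.TTheory GRing.Theory Num.Theory.
Import numFieldNormedType.Exports.

Local Open Scope classical_set_scope.
Local Open Scope ring_scope.

(** * Powers of a generating set *)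

Section SetPow.
Variable G : groupType.
Implicit Types (Omega : set G) (x y : G).

Lemma set_powD Omega m n x y :
  set_pow Omega m x -> set_pow Omega n y -> set_pow Omega (m + n) (x * y)%g.
Proof.
elim: m x => [|m IHm] x /=; first by move=> ->; rewrite mul1g.
move=> [u Ou [v Ov <-]] Oy; exists u => //; exists (v * y)%g; first exact: IHm.
by rewrite mulgA.
Qed.

Lemma set_pow1 Omega x : Omega x -> set_pow Omega 1 x.
Proof. by move=> Ox; exists x => //; exists 1%g => //; rewrite mulg1. Qed.

Lemma set_powX Omega n x : Omega x -> set_pow Omega n (x ^+ n)%g.
Proof.
move=> Ox; elim: n => [//|n IHn]; rewrite expgS -add1n.
by apply: set_powD IHn; exact: set_pow1.
Qed.

Lemma set_powV Omega n x :
  symmetric_set Omega -> set_pow Omega n x -> set_pow Omega n x^-1%g.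
Proof.
move=> symO; elim: n x => [|n IHn] x; first by move=> ->; rewrite invg1.
move=> [u Ou [v Ov <-]]; rewrite invgM -addn1.
by apply: set_powD; [exact: IHn | apply: set_pow1; exact: symO].
Qed.

Lemma finite_set_pow Omega n : finite_set Omega -> finite_set (set_pow Omega n).
Proof.
move=> finO; elim: n => [|n IHn] /=; first exact: finite_set1.
exact: finite_image2.
Qed.

(** The union of the powers of a symmetric set is already a subgroup. *)
Lemma generates_set_pow Omega :
  symmetric_set Omega -> generates Omega ->
  forall x, exists n, set_pow Omega n x.
Proof.
move=> symO genO x.
suff: smallest (@is_subgroup G) Omega `<=` [set x | exists n, set_pow Omega n x].
  by rewrite genO; apply.
apply: smallest_sub => [|y Oy]; last by exists 1%N; exact: set_pow1.
split; first by exists 0%N.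
move=> y z [m Om] [n On]; exists (m + n)%N; apply: set_powD => //.
exact: set_powV.
Qed.

Lemma generatesP Omega :
  (forall K, is_subgroup K -> Omega `<=` K -> forall x, K x) ->
  generates Omega.
Proof.
by move=> H; apply/seteqP; split=> // x _ K [sgK OK]; exact: H.
Qed.

Lemma subgroupV (K : set G) x : is_subgroup K -> K x -> K x^-1%g.
Proof. by move=> [K1 KD] Kx; rewrite -[x^-1%g]mul1g; exact: KD. Qed.

Lemma subgroupM (K : set G) x y : is_subgroup K -> K x -> K y -> K (x * y)%g.
Proof.
move=> sgK Kx Ky; rewrite -[y]invgK; apply: sgK.2 => //; exact: subgroupV.
Qed.

Lemma subgroupX (K : set G) x n : is_subgroup K -> K x -> K (x ^+ n)%g.
Proof.
move=> sgK Kx; elim: n => [|n IHn]; first exact: sgK.1.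
by rewrite expgS; exact: subgroupM.
Qed.

End SetPow.

(** * Word length *)

Section WordLength.
Variables (R : realType) (G : groupType) (Omega : set G).
Hypothesis symO : symmetric_set Omega.
Hypothesis genO : generates Omega.
Implicit Types x y : G.

Local Notation len := (word_dist R Omega 1%g).

Lemma word_dist_le n x : set_pow Omega n x -> len x <= n%:R.
Proof.
move=> On; apply: ge_inf; last by exists n => //=; rewrite invg1 mul1g.
by exists 0 => _ [k _ <-].
Qed.

(** This is where generation matters: the infimum over an empty set of exponents
    would be the default value 0, and subadditivity would fail. *)
Lemma word_dist_attained x : exists2 n, set_pow Omega n x & len x = n%:R.
Proof.
have exn : exists n, `[< set_pow Omega n x >].
  by have [n On] := generates_set_pow symO genO x; exists n; apply/asboolP.
case: (ex_minnP exn) => n /asboolP On nmin; exists n => //.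
apply/eqP; rewrite eq_le word_dist_le //=; apply: lb_le_inf.
  by exists n%:R; exists n => //=; rewrite invg1 mul1g.
move=> _ [k /= + <-]; rewrite invg1 mul1g => Ok.
by rewrite ler_nat; apply: nmin; apply/asboolP.
Qed.

Lemma word_dist_ge0 x : 0 <= len x.
Proof. by have [n _ ->] := word_dist_attained x. Qed.

Lemma word_dist1 : len 1%g = 0.
Proof. by apply/eqP; rewrite eq_le word_dist_ge0 (@word_dist_le 0). Qed.

Lemma word_distM x y : len (x * y)%g <= len x + len y.
Proof.
have [m Om ->] := word_dist_attained x; have [n On ->] := word_dist_attained y.
by rewrite -natrD; apply: word_dist_le; exact: set_powD.
Qed.

Lemma word_distV x : len x^-1%g = len x.
Proof.
suff leV y : len y^-1%g <= len y.
  by apply/eqP; rewrite eq_le leV -{1}[x]invgK leV.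
by have [n On ->] := word_dist_attained y; apply: word_dist_le; exact: set_powV.
Qed.

Lemma word_distX x n : len (x ^+ n)%g <= n%:R * len x.
Proof.
elim: n => [|n IHn]; first by rewrite expg0 word_dist1 mul0r.
by rewrite expgS (le_trans (word_distM _ _))// mulrSr mulrDl mul1r addrC lerD2r.
Qed.

Lemma word_dist_perturb x y : `|len (x * y)%g - len x| <= len y.
Proof.
have le1 := word_distM x y.
have := word_distM (x * y)%g y^-1%g; rewrite mulgK word_distV => le2.
by rewrite ler_norml; lra.
Qed.

Lemma finite_ball (r : R) : finite_set Omega -> finite_set [set x | len x <= r].
Proof.
move=> finO.
apply: (@sub_finite_set _ _ (\bigcup_(n in `I_(Num.bound `|r|).+1) set_pow Omega n)).
  move=> x /=; have [n On ->] := word_dist_attained x => nr.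
  exists n => //=; rewrite ltnS -(ler_nat R); apply: le_trans nr _.
  exact: le_trans (ler_norm r) (ltW (archi_boundP (normr_ge0 r))).
by apply: bigcup_finite => [|n _]; [exact: finite_II | exact: finite_set_pow].
Qed.

(** A finite ball cannot contain infinitely many distinct powers of [c]. *)
Lemma word_dist_unbounded (c : G) (M : R) : finite_set Omega ->
  injective (fun n => c ^+ n)%g -> exists n, M < len (c ^+ n)%g.
Proof.
move=> finO injc; apply: contrapT => noM.
apply: infinite_nat.
have := finite_preimage (in2W injc) (finite_ball M finO).
apply: sub_finite_set => n _ /=; rewrite leNgt; apply/negP => Mn.
by apply: noM; exists n.
Qed.

End WordLength.

(** * Distorted elements *)

(** By subadditivity of the length this is equivalent to the usual condition
    that the length of [c ^+ n], divided by [n], tends to 0; one small ratio for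
    each [eps] is what the commutator identity gives directly. *)
Definition distorted (R : realType) (G : groupType) (Omega : set G) (c : G) :=
  forall eps : R, 0 < eps ->
    exists2 n, (0 < n)%N & word_dist R Omega 1%g (c ^+ n)%g <= eps * n%:R.

(** Write [n] as a multiple of an exponent [d] with small ratio plus a remainder
    below [d]; the remainder costs at most the constant [B]. *)
Lemma distorted_affine (R : realType) (G : groupType) (Omega : set G) (c : G)
    (eps : R) :
  symmetric_set Omega -> generates Omega -> distorted R Omega c -> 0 < eps ->
  exists B : R, forall n, word_dist R Omega 1%g (c ^+ n)%g <= eps * n%:R + B.
Proof.
move=> symO genO dist eps0; have [d d0 led] := dist _ eps0.
exists (d%:R * word_dist R Omega 1%g c) => n.
rewrite {1}(divn_eq n d) expgnDr mulnC expgnA.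
apply: (le_trans (word_distM _ symO genO _ _)); apply: lerD.
  apply: (le_trans (word_distX _ symO genO _ _)).
  have -> : eps * n%:R = eps * (n %/ d * d)%:R + eps * (n %% d)%:R.
    by rewrite -mulrDr -natrD -divn_eq.
  rewrite ler_wpDr ?mulr_ge0 ?ler0n ?(ltW eps0)// natrM mulrCA.
  by apply: ler_wpM2l.
apply: (le_trans (word_distX _ symO genO _ _)).
apply: ler_wpM2r; first exact: word_dist_ge0.
by rewrite ler_nat ltnW// ltn_pmod.
Qed.

(** * Integer powers *)

Section Zpow.
Variables (G : groupType) (c : G).

Definition zpow (m : int) : G :=
  match m with Posz n => c ^+ n | Negz n => c ^- n.+1 end%g.

(** Computing on formal differences of naturals avoids the sign cases in the
    additivity of [zpow]. *)
Lemma zpowB (p q : nat) : zpow (p%:Z - q%:Z) = (c ^+ p / c ^+ q)%g.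
Proof.
have [qp|/ltnW pq] := leqP q p.
  by rewrite subzn//= expgnFr.
rewrite -[_ - _]opprB subzn//.
have -> : zpow (- (q - p)%:Z) = (c ^- (q - p))%g.
  by case: (q - p)%N => //=; rewrite invg1.
by rewrite expgnFr// invgM invgK.
Qed.

Lemma zpowD m n : zpow (m + n) = (zpow m * zpow n)%g.
Proof.
have split_int k : exists p q : nat, k = p%:Z - q%:Z.
  case: k => k; first by exists k, 0%N; rewrite subr0.
  by exists 0%N, k.+1; rewrite NegzE sub0r.
have [p [q ->]] := split_int m; have [r [s ->]] := split_int n.
have -> : p%:Z - q%:Z + (r%:Z - s%:Z) = (p + r)%N%:Z - (s + q)%N%:Z by lia.
rewrite !zpowB !expgnDr invgM -!mulgA; congr (_ * _)%g; rewrite !mulgA.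
have cX i : commute (c ^- q) (c ^+ i)%g.
  by apply/commute_sym/commuteV; apply: commuteX2.
have -> : (c ^- q * c ^+ r = c ^+ r * c ^- q)%g by exact: cX.
by rewrite -!mulgA; congr (_ * _)%g; apply/commuteV/cX.
Qed.

Lemma zpowN m : zpow (- m) = (zpow m)^-1%g.
Proof. by apply/esym/mulg1_eq; rewrite -zpowD subrr. Qed.

Lemma zpow_commute x m : commute x c -> commute x (zpow m).
Proof.
by move=> xc; case: m => n /=; [|apply: commuteV]; apply: commuteX.
Qed.

Lemma word_dist_zpow (R : realType) (Omega : set G) (m : int) :
  symmetric_set Omega -> generates Omega ->
  word_dist R Omega 1%g (zpow m) = word_dist R Omega 1%g (c ^+ `|m|)%g.
Proof. by move=> symO genO; case: m => n //=; rewrite word_distV. Qed.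

End Zpow.

(** * Transport along automorphisms *)

Section Image.
Variables (G : groupType) (f : G -> G).
Hypothesis fM : {morph f : x y / (x * y)%g}.
Hypothesis f_bij : bijective f.
Variable Omega : set G.

Let f1 : f 1%g = 1%g.
Proof. by apply: (@mulgI _ (f 1%g)); rewrite -fM !mulg1. Qed.

Let fV x : f x^-1%g = (f x)^-1%g.
Proof. by apply/esym/mulg1_eq; rewrite -fM mulgV f1. Qed.

Lemma set_pow_image n x : set_pow (f @` Omega) n (f x) <-> set_pow Omega n x.
Proof.
have inj := bij_inj f_bij.
elim: n x => [|n IHn] x /=.
  by rewrite -{1}f1; split=> [/inj|->].
split=> [[_ [u Ou <-] [v Ov]]|[u Ou [v Ov <-]]].
  case: f_bij => g _ gK; rewrite -(gK v) -fM => /inj <-; exists u => //.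
  by exists (g v) => //; apply/IHn; rewrite gK.
by exists (f u); [exists u | exists (f v); [exact/IHn | rewrite fM]].
Qed.

Lemma symmetric_image : symmetric_set Omega -> symmetric_set (f @` Omega).
Proof.
by move=> symO _ [u Ou <-]; exists u^-1%g; [exact: symO | rewrite fV].
Qed.

Lemma generates_image : generates Omega -> generates (f @` Omega).
Proof.
move=> genO; apply: generatesP => K sgK OK x.
case: f_bij => g _ gK; rewrite -(gK x).
suff: smallest (@is_subgroup G) Omega `<=` f @^-1` K by rewrite genO; apply.
apply: smallest_sub => [|u Ou]; last by apply: OK; exists u.
split=> [|y z Ky Kz] /=; first by rewrite f1; exact: sgK.1.
by rewrite fM fV; exact: sgK.2.
Qed.

Lemma word_dist_image (R : realType) x :
  word_dist R (f @` Omega) 1%g (f x) = word_dist R Omega 1%g x.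
Proof.
rewrite /word_dist invg1 !mul1g; congr (inf _); congr (image _ _).
by apply/seteqP; split=> n /set_pow_image.
Qed.

End Image.

(** * Direct products *)

Section DirProdOps.
Variables G H : groupType.

Lemma dirprodM (x y : dirprod G H) : (x * y)%g = (x.1 * y.1, x.2 * y.2)%g.
Proof. by []. Qed.

Lemma dirprodV (x : dirprod G H) : (x^-1)%g = (x.1^-1, x.2^-1)%g.
Proof. by []. Qed.

Lemma dirprodX (x : dirprod G H) n : (x ^+ n)%g = (x.1 ^+ n, x.2 ^+ n)%g.
Proof. by elim: n => [//|n IHn]; rewrite !expgS IHn dirprodM. Qed.

End DirProdOps.

(** * The split word metric on a product with the integers *)

Local Notation Zmul := (Algebra.to_multiplicative int).

Section Product.
Variables (R : realType) (G : groupType) (S : set G).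
Hypothesis symS : symmetric_set S.
Hypothesis genS : generates S.
Local Notation GZ := (dirprod G Zmul).
Local Notation len := (word_dist R S 1%g).

Definition split_gens : set GZ :=
  [set g | S g.1 /\ g.2 = 0 \/ g.1 = 1%g /\ (g.2 = 1 \/ g.2 = -1)].

Lemma symmetric_split_gens : symmetric_set split_gens.
Proof.
move=> [h m] [[/= Sh ->]|[/= -> [->|->]]]; [left|right|right].
- by split; [exact: symS | exact: (@oppr0 int)].
- by split; [exact: invg1 | right].
- by split; [exact: invg1 | left].
Qed.

Lemma finite_split_gens : finite_set S -> finite_set split_gens.
Proof.
move=> finS.
pose T : set int := [set 0; 1; -1].
have finT : finite_set T.
  by rewrite /T !finite_setU; split; [split|]; exact: finite_set1.
apply: (@sub_finite_set _ _ ((S `|` [set 1%g]) `*` T)).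
  by move=> [h m] [[/= Sh ->]|[/= -> [->|->]]]; split => /=; rewrite /T /=; tauto.
by apply: finite_setX => //; rewrite finite_setU; split=> //; exact: finite_set1.
Qed.

Lemma generates_split_gens : generates split_gens.
Proof.
apply: generatesP => K sgK SK [h m].
have Kh : K (h, 0 : Zmul).
  suff: smallest (@is_subgroup G) S `<=` [set h | K (h, 0 : Zmul)].
    by rewrite genS; apply.
  apply: smallest_sub => [|u Su]; last by apply: SK; left.
  split; first exact: sgK.1.
  by move=> x y Kx Ky; have := sgK.2 _ _ Kx Ky.
have Km : K (1%g, m : Zmul).
  have K1 : K (1%g, 1 : Zmul) by apply: SK; right; split=> //; left.
  have Kn (n : nat) : K (1%g, n%:Z : Zmul).
    by have := subgroupX n sgK K1; rewrite dirprodX /= expg1n [X in K (_, X)]natz.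
  case: m => n; first exact: Kn.
  by have := subgroupV sgK (Kn n.+1); rewrite dirprodV /= invg1.
have := subgroupM sgK Kh Km.
by rewrite dirprodM /= mulg1 [X in K (_, X)]add0r.
Qed.

(** Deleting the letters from the [Z] factor leaves a word for [g.1]; at least
    [`|g.2|] letters are deleted. *)
Lemma set_pow_split n (g : GZ) : set_pow split_gens n g ->
  exists2 k, set_pow S k g.1 & (k + `|g.2 : int| <= n)%N.
Proof.
elim: n g => [|n IHn] g; first by move=> ->; exists 0%N.
move=> [u Su [v /IHn[k Sk kn] <-]].
case: u Su => s t /= [[/= Ss ->]|[/= -> t1]].
  exists k.+1; first by exists s => //; exists v.1.
  (* The multiplicative notation hides the addition of integers. *)
  change (k.+1 + `|(0 + (v.2 : int))%R| <= n.+1)%N; lia.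
exists k; first by rewrite mul1g.
change (k + `|((t : int) + (v.2 : int))%R| <= n.+1)%N.
by case: t1 => ->; lia.
Qed.

Lemma word_dist_split (g : GZ) :
  word_dist R split_gens 1%g g = len g.1 + `|g.2 : int|%:R.
Proof.
case: g => h m /=; apply/eqP; rewrite eq_le; apply/andP; split.
  have [k Sk ->] := word_dist_attained R symS genS h; rewrite -natrD.
  apply: word_dist_le.
  have -> : (h, m) = ((h, 0 : Zmul) * (1%g, m))%g :> GZ.
    by rewrite dirprodM /= mulg1; congr pair; rewrite [RHS]add0r.
  apply: set_powD.
    elim: k h Sk => [|k IHk] h; first by move=> ->.
    move=> [u Su [v Sv <-]]; exists (u, 0 : Zmul); first by left.
    by exists (v, 0 : Zmul) => //; exact: IHk.
  have pw (s : int) n : s = 1 \/ s = -1 ->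
      set_pow split_gens n (1%g, s *+ n : Zmul).
    move=> s1; have := @set_powX _ split_gens n (1%g, s : Zmul).
    by rewrite dirprodX /= expg1n; apply; right.
  case: m => n /=; first by have := pw 1 n (or_introl erefl); rewrite natz.
  by have := pw (-1) n.+1 (or_intror erefl); rewrite mulNrn natz -NegzE.
have [n On ->] := word_dist_attained R symmetric_split_gens generates_split_gens (h, m).
have [k Sk kn] := set_pow_split On.
apply: le_trans (_ : (k + `|m : int|)%:R <= _); last by rewrite ler_nat.
by rewrite natrD lerD2r; exact: word_dist_le.
Qed.

End Product.

Lemma frechet_filter_filter (T : Type) : Filter (@frechet_filter T).
Proof.
rewrite /frechet_filter; constructor; first by rewrite /= setCT.
- by move=> A B; rewrite /= setCI finite_setU.
- by move=> A B AB; exact/sub_finite_set/subsetC.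
Qed.

(** * Shearing the split metric along a distorted central element *)

Section Shear.
Variables (R : realType) (G : groupType) (S : set G) (c : G).
Hypothesis finS : finite_set S.
Hypothesis symS : symmetric_set S.
Hypothesis genS : generates S.
Hypothesis c_central : forall x : G, commute x c.
Local Notation GZ := (dirprod G Zmul).
Local Notation len := (word_dist R S 1%g).

Definition shear (k : int) (g : GZ) : GZ :=
  ((g.1 * zpow c (k * (g.2 : int)))%g, g.2).

Lemma shearM k : {morph shear k : x y / (x * y)%g}.
Proof.
move=> [x m] [y n]; rewrite /shear !dirprodM /=; congr pair.
rewrite [(m * n)%g]/(m + n : int) mulrDr zpowD -!mulgA; congr (_ * _)%g.
by rewrite !mulgA; congr (_ * _)%g; apply: zpow_commute.
Qed.

Lemma shearK k : cancel (shear k) (shear (- k)).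
Proof. by move=> [x m]; rewrite /shear /= mulNr zpowN mulgK. Qed.

Lemma shearNK k : cancel (shear (- k)) (shear k).
Proof. by move=> g; rewrite -[X in shear X (shear _ _)]opprK shearK. Qed.

Lemma shear_bij k : bijective (shear k).
Proof. by exists (shear (- k)); [exact: shearK | exact: shearNK]. Qed.

Local Notation rho1 := (word_dist R (split_gens S)).
Local Notation rho2 := (word_dist R (shear 1 @` split_gens S)).

(** [g] is the shear of [(g.1 * c^(- g.2), g.2)], whose split length is known. *)
Lemma word_dist_shear (g : GZ) :
  rho2 1%g g = len (g.1 * zpow c (- (g.2 : int)))%g + `|g.2 : int|%:R.
Proof.
rewrite -{1}[g](shearNK 1).
rewrite (word_dist_image (shearM 1) (shear_bij 1)) word_dist_split//=.
by rewrite mulN1r.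
Qed.

Lemma finite_rho2_ball r : finite_set [set g | rho2 1%g g <= r].
Proof.
apply: finite_ball.
- apply: (symmetric_image (shearM 1)); exact: symmetric_split_gens.
- apply: (generates_image (shearM 1) (shear_bij 1)).
  exact: generates_split_gens.
- by apply: finite_image; exact: finite_split_gens.
Qed.

Lemma rho_close (g : GZ) :
  `|rho1 1%g g - rho2 1%g g| <= len (c ^+ `|g.2 : int|)%g.
Proof.
rewrite word_dist_shear word_dist_split// opprD addrACA subrr addr0 distrC.
apply: le_trans (word_dist_perturb _ symS genS _ _) _.
by rewrite word_dist_zpow// abszN.
Qed.

(** The difference is at most [eps / 2 * |m| + B] with [|m|] below the length for
    [rho2]; outside a finite ball of [rho2] the constant [B] is absorbed too. *)
Lemma rho_asymptotic : distorted R S c ->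
  (rho1 1%g g / rho2 1%g g)
    @[g --> (@frechet_filter GZ : set_system GZ)] --> (1 : R).
Proof.
move=> dist; have fF := frechet_filter_filter GZ; apply/cvgrPdist_le => eps eps0.
have eps20 : 0 < eps / 2 by lra.
have [B leB] := distorted_affine symS genS dist eps20.
pose r := Num.max 0 (B / (eps / 2)).
have far : \forall g \near (@frechet_filter GZ : set_system GZ), r < rho2 1%g g.
  apply: sub_finite_set (finite_rho2_ball r) => g /= /negP.
  by rewrite -leNgt.
near=> g.
have [rho0 rhoB] : 0 < rho2 1%g g /\ B <= eps / 2 * rho2 1%g g.
  have : r < rho2 1%g g by near: g.
  by rewrite gt_max => /andP[-> /ltW]; rewrite ler_pdivrMr// mulrC.
have -> : 1 - rho1 1%g g / rho2 1%g g = (rho2 1%g g - rho1 1%g g) / rho2 1%g g.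
  by rewrite mulrBl divff ?gt_eqF.
rewrite normrM normfV (gtr0_norm rho0) ler_pdivrMr// distrC.
apply: le_trans (rho_close g) _; apply: le_trans (leB _) _.
suff: eps / 2 * `|g.2 : int|%:R <= eps / 2 * rho2 1%g g by lra.
rewrite ler_wpM2l ?(ltW eps20)// word_dist_shear lerDr.
exact: word_dist_ge0.
Unshelve. all: by end_near.
Qed.

(** On [(c^n, n)], the shear of [(1, n)], the two lengths differ by exactly the
    length of [c^n]. *)
Lemma rho_unbounded (M : R) : injective (fun n => c ^+ n)%g ->
  exists g : GZ, M < `|rho1 1%g g - rho2 1%g g|.
Proof.
move=> injc; have [n Mn] := word_dist_unbounded symS genS M finS injc.
exists ((c ^+ n)%g, n : Zmul).
rewrite word_dist_shear word_dist_split//= opprD addrACA subrr addr0 zpowN /= mulgV.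
rewrite word_dist1// subr0; apply: lt_le_trans Mn _; exact: ler_norm.
Qed.

Lemma asymptotic_not_close : distorted R S c -> injective (fun n => c ^+ n)%g ->
  exists rho1 rho2 : GZ -> GZ -> R,
    [/\ is_word_metric rho1,
        is_word_metric rho2,
        (rho1 1%g g / rho2 1%g g)
          @[g --> (@frechet_filter GZ : set_system GZ)] --> (1 : R)
      & forall M : R, exists g : GZ, M < `|rho1 1%g g - rho2 1%g g|].
Proof.
move=> dist injc; exists rho1, rho2; split.
- exists (split_gens S); split=> //; first exact: finite_split_gens.
    exact: symmetric_split_gens.
  exact: generates_split_gens.
- exists (shear 1 @` split_gens S); split=> //.
  + by apply: finite_image; exact: finite_split_gens.
  + apply: (symmetric_image (shearM 1)); exact: symmetric_split_gens.
  + apply: (generates_image (shearM 1) (shear_bij 1)).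
    exact: generates_split_gens.
- exact: rho_asymptotic.
- by move=> M; exact: rho_unbounded.
Qed.

End Shear.

(** * The Heisenberg group *)

Section Commutators.
Variable G : groupType.
Implicit Types x y : G.

(** Conjugation by [y] sends [x] to [x * [~ x, y]], a product of commuting
    factors. *)
Lemma commXg_central x y n :
  commute x [~ x, y]%g -> [~ x ^+ n, y]%g = ([~ x, y] ^+ n)%g.
Proof.
move=> cx; rewrite commgEl conjXg.
have -> : (x ^ y = x * [~ x, y])%g by rewrite commgEl mulVKg.
by rewrite expgMn// mulKg.
Qed.

Lemma commXX_central x y m n :
  commute x [~ x, y]%g -> commute y [~ x, y]%g ->
  [~ x ^+ m, y ^+ n]%g = ([~ x, y] ^+ (m * n))%g.
Proof.
move=> cx cy.
have cyX : [~ x, y ^+ n]%g = ([~ x, y] ^+ n)%g.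
  rewrite -invgR commXg_central; last by rewrite -invgR; exact: commuteV.
  by rewrite -(invgR x y) expVgn invgK.
rewrite commXg_central cyX; first by rewrite mulnC expgnA.
exact: commuteX.
Qed.

(** The power [n * n] of the commutator is [[~ x ^+ n, y ^+ n]], a word of length
    [4 * n]. *)
Lemma distorted_commutator (R : realType) (S : set G) x y :
  symmetric_set S -> S x -> S y ->
  commute x [~ x, y]%g -> commute y [~ x, y]%g -> distorted R S [~ x, y]%g.
Proof.
move=> symS Sx Sy cx cy eps eps0.
(* This choice makes 4 n at most eps n^2. *)
pose n := (Num.bound (4 / eps)).+1.
exists (n * n)%N => //; rewrite -commXX_central//.
have powX z : S z -> set_pow S n (z ^+ n)%g by exact: set_powX.
have powV z : S z -> set_pow S n (z ^- n)%g.
  by move=> Sz; apply: set_powV => //; exact: powX.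
apply: (@le_trans _ _ (n + (n + (n + n)))%N%:R).
  apply: word_dist_le; rewrite commgEl conjgE.
  apply: set_powD; first exact: powV.
  apply: set_powD; first exact: powV.
  by apply: set_powD; exact: powX.
have -> : (n + (n + (n + n)) = 4 * n)%N by lia.
rewrite !natrM mulrA ler_wpM2r ?ler0n// mulrC -ler_pdivrMr//.
rewrite (le_trans (ltW (archi_boundP _)))// ?divr_ge0 ?(ltW eps0)//.
by rewrite ler_nat.
Qed.

End Commutators.

Local Open Scope quotient_scope.

Definition heis_word (w : word bool) : H3Z := \pi_(presented heis_rels) w.

Lemma heis_word_cat u v : heis_word (u ++ v) = (heis_word u * heis_word v)%g.
Proof. by apply/esym; exact: pres_pi_mul. Qed.

Lemma heis_word_inv w : heis_word (inv_word w) = (heis_word w)^-1%g.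
Proof.
apply/esym/mulg1_eq; rewrite -heis_word_cat.
by apply: (@pres_piP _ heis_rels _ [::]).2; exact: pres_wordV.
Qed.

Lemma heis_word_comm u v :
  heis_word (comm_word u v) = [~ heis_word u, heis_word v]%g.
Proof. by rewrite /comm_word !heis_word_cat !heis_word_inv commgEl conjgE. Qed.

Definition heis_gens : set H3Z := range (fun l => heis_word [:: l]).

Lemma finite_heis_gens : finite_set heis_gens.
Proof. by apply: finite_image; exact: finite_finset. Qed.

Lemma symmetric_heis_gens : symmetric_set heis_gens.
Proof.
by move=> _ [l _ <-]; exists (inv_letter l) => //; rewrite -heis_word_inv.
Qed.

(** Induction on a representing word. *)
Lemma heis_ind (P : H3Z -> Prop) :
  P 1%g -> (forall l g, P g -> P (heis_word [:: l] * g)%g) -> forall g, P g.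
Proof.
move=> P1 PM g; rewrite -[g]reprK -/(heis_word _).
elim: (repr _) => [|l w IHw]; first exact: P1.
by have := PM l _ IHw; rewrite -heis_word_cat.
Qed.

Lemma generates_heis_gens : generates heis_gens.
Proof.
apply: generatesP => K sgK SK; apply: heis_ind; first exact: sgK.1.
by move=> l g Kg; apply: subgroupM => //; apply: SK; exists l.
Qed.

Definition heis_a := heis_word (gen_word false).
Definition heis_b := heis_word (gen_word true).
Definition heis_z := [~ heis_a, heis_b]%g.

Lemma heis_zE : heis_z = heis_word (comm_word (gen_word false) (gen_word true)).
Proof. by rewrite heis_word_comm. Qed.

Lemma heis_rel_commute i : commute (heis_word (gen_word i)) heis_z.
Proof.
apply/commgP/eqP; rewrite heis_zE -heis_word_comm.
apply: (@pres_piP _ heis_rels _ [::]).2; apply: pres_rel. by case: i; [right | left].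
Qed.

Lemma heis_z_central (g : H3Z) : commute g heis_z.
Proof.
elim/heis_ind: g => [|[i e] g cg]; first exact: (commute_sym (commute1 _)).
apply: commute_sym; apply: commuteM; apply: commute_sym => //.
case: e; last exact: heis_rel_commute.
have -> : heis_word [:: (i, true)] = (heis_word (gen_word i))^-1%g.
  by rewrite -heis_word_inv.
by apply: commute_sym; apply: commuteV; apply: commute_sym; exact: heis_rel_commute.
Qed.

(** Left multiplication by the generators in the group of integer triples with law
    [(x, y, z) (x', y', z') = (x + x', y + y', z + z' + x y')].  Working with
    the action on triples instead of with a morphism spares the construction of
    this second group. *)
Definition heis_act1 (l : bool * bool) (t : int * int * int) :=
  let: (x, y, z) := t in
  let s : int := if l.2 then -1 else 1 in
  if l.1 then (x, y + s, z) else (x + s, y, z + s * y).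

Definition heis_act (w : word bool) (t : int * int * int) := foldr heis_act1 t w.

Lemma heis_act_cat u v t : heis_act (u ++ v) t = heis_act u (heis_act v t).
Proof. exact: foldr_cat. Qed.

Lemma heis_act_cong u v : pres_cong heis_rels u v -> heis_act u =1 heis_act v.
Proof.
elim=> {u v} [//|u v _ uv|u v w _ uv _ vw|u u' v v' _ uu _ vv|[i e]|r rel] t.
- by rewrite uv.
- by rewrite uv vw.
- by rewrite !heis_act_cat vv uu.
- case: t => [[x y] z].
  by case: i e => [] [] /=; congr (_, _, _); ring.
- case: t => [[x y] z].
  by case: rel => ->; rewrite /heis_act /=; congr (_, _, _); ring.
Qed.

Lemma heis_act_repr w : heis_act (repr (heis_word w)) =1 heis_act w.
Proof. by apply: heis_act_cong; exact: pres_repr. Qed.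

Lemma heis_act_z n : heis_act (repr (heis_z ^+ n)%g) (0, 0, 0) = (0, 0, n%:Z).
Proof.
elim: n => [|n IHn]; first exact: heis_act_repr.
rewrite expgS -[(_ * _)%g]/(heis_word _) heis_act_repr heis_act_cat IHn.
rewrite heis_zE heis_act_repr /=.
by congr (_, _, _); lia.
Qed.

Lemma heis_z_inj : injective (fun n => heis_z ^+ n)%g.
Proof. by move=> m n /= e; have := heis_act_z m; rewrite e heis_act_z => -[]. Qed.

Unset Implicit Arguments.

Theorem mainTheorem13 (R : realType) :
  exists rho1 rho2 : Gamma -> Gamma -> R,
    [/\ is_word_metric rho1,
        is_word_metric rho2,
        (rho1 1%g g / rho2 1%g g) @[g --> (@frechet_filter Gamma : set_system Gamma)] --> (1 : R)
      & forall M : R, exists g : Gamma, M < `|rho1 1%g g - rho2 1%g g|].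
Proof.
have gen i : heis_gens (heis_word (gen_word i)) by exists (i, false).
apply: (asymptotic_not_close finite_heis_gens symmetric_heis_gens
  generates_heis_gens heis_z_central); last exact: heis_z_inj.
apply: (distorted_commutator symmetric_heis_gens);
  [exact: gen | exact: gen | exact: heis_rel_commute | exact: heis_rel_commute].
Qed.
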